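(* Let $C(q)$ be a formal power series with $C(0)=1$, let $c_j:=[q^j]\frac{1}{C(q)}$ for $j\ge0$ and $c_j:=0$ for $j<0$, and let $\gamma:\mathbb{Z}^{+}\to\mathbb{C}$ be a function with $\gamma(1)\neq 0$. Define \[ s^{(-1)}_{n,k}(\gamma):=\sum_{d\mid n}c_{d-k}\,\gamma(n/d)\qquad(n,k\ge 1), \] which is lower triangular in $(n,k)$ with diagonal entries $\gamma(1)$, and let $s_{n,k}(\gamma)$ denote the entries of the inverse lower-triangular matrix. Let $\widetilde{\gamma}(n):=\sum_{d\mid n}\gamma(d)$. For an arbitrary sequence $\{a_n\}_{n\ge1}$ of complex numbers define \[ \widetilde{a}_k(\gamma):=\sum_{d\mid k}a_d\,\widetilde{\gamma}(k/d). \] Then, as formal power series in $q$, \[ \sum_{n\ge1}\frac{a_nq^n}{1-q^n}=\frac{1}{C(q)}\sum_{n\ge1}\sum_{k=1}^{n}s_{n,k}(\gamma)\,\widetilde{a}_k(\gamma)\,q^n . \]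
   Context: $[q^j]F(q)$ denotes the coefficient of $q^j$ in a formal power series $F(q)$. *)

(* Defs.v *)
From HB Require Import structures.
From mathcomp Require Import all_boot all_order all_algebra.
From mathcomp Require Import boolp reals.
From mathcomp.real_closed Require Import complex.

Set Implicit Arguments.
Unset Strict Implicit.
Unset Printing Implicit Defensive.

Import GRing.Theory.
Local Open Scope ring_scope.

(* The ring of formal power series in one variable, with [fpsX] the variable
   and the Cauchy product as multiplication. *)
Record fps (K : Type) := Fps { fpscoef : nat -> K }.

Notation "'[q^' j ] F" := (fpscoef F j)
  (at level 10, j at level 200, F at level 8) : ring_scope.

Lemma fpsP (K : Type) (f g : fps K) :
  (forall j, fpscoef f j = fpscoef g j) -> f = g.
Proof. by case: f g => [f] [g] /= /funext ->. Qed.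

HB.instance Definition _ (K : Type) := gen_eqMixin (fps K).
HB.instance Definition _ (K : Type) := gen_choiceMixin (fps K).

Section FpsRing.
Variable K : comUnitRingType.
Implicit Types f g h : fps K.

Definition fps_zero : fps K := Fps (fun=> 0).
Definition fps_opp f : fps K := Fps (fun j => - [q^ j] f).
Definition fps_add f g : fps K := Fps (fun j => [q^ j] f + [q^ j] g).

Fact fps_addA : associative fps_add.
Proof. by move=> f g h; apply: fpsP => j /=; rewrite addrA. Qed.
Fact fps_addC : commutative fps_add.
Proof. by move=> f g; apply: fpsP => j /=; rewrite addrC. Qed.
Fact fps_add0 : left_id fps_zero fps_add.
Proof. by move=> f; apply: fpsP => j /=; rewrite add0r. Qed.
Fact fps_addN : left_inverse fps_zero fps_opp fps_add.
Proof. by move=> f; apply: fpsP => j /=; rewrite addNr. Qed.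

HB.instance Definition _ :=
  GRing.isZmodule.Build (fps K) fps_addA fps_addC fps_add0 fps_addN.

Definition fps_one : fps K := Fps (fun j => (j == 0%N)%:R).
Definition fps_mul f g : fps K :=
  Fps (fun n => \sum_(i < n.+1) [q^ i] f * [q^ (n - i)] g).

Let trunc n f : {poly K} := \poly_(i < n.+1) [q^ i] f.

Let trunc_coef n f i : (i <= n)%N -> (trunc n f)`_i = [q^ i] f.
Proof. by move=> le_in; rewrite coef_poly ltnS le_in. Qed.

Let trunc_mul n f g i : (i <= n)%N ->
  [q^ i] (fps_mul f g) = (trunc n f * trunc n g)`_i.
Proof.
move=> le_in; rewrite coefM /=; apply: eq_bigr => j _.
have le_ji : (j <= i)%N by rewrite -ltnS.
by rewrite !trunc_coef ?(leq_trans _ le_in) ?leq_subr.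
Qed.

Fact fps_mulC : commutative fps_mul.
Proof.
by move=> f g; apply: fpsP => n; rewrite !(trunc_mul _ _ (leqnn n)) mulrC.
Qed.

Fact fps_mulA : associative fps_mul.
Proof.
move=> f g h; apply: fpsP => n; rewrite !(trunc_mul _ _ (leqnn n)).
have tmul f1 f2 i : (i <= n)%N ->
    (trunc n (fps_mul f1 f2))`_i = (trunc n f1 * trunc n f2)`_i.
  by move=> le_in; rewrite trunc_coef // (trunc_mul _ _ le_in).
transitivity (trunc n f * (trunc n g * trunc n h))`_n.
  rewrite !coefM; apply: eq_bigr => i _; congr (_ * _).
  by rewrite tmul ?leq_subr.
rewrite mulrA !coefM; apply: eq_bigr => i _; congr (_ * _).
by rewrite tmul // -ltnS.
Qed.

Fact fps_mul1 : left_id fps_one fps_mul.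
Proof.
move=> f; apply: fpsP => n /=.
rewrite big_ord_recl /= mul1r subn0 big1 ?addr0 // => i _.
by rewrite mul0r.
Qed.

Fact fps_mulDl : left_distributive fps_mul +%R.
Proof.
move=> f g h; apply: fpsP => n /=; rewrite -big_split /=.
by apply: eq_bigr => i _; rewrite mulrDl.
Qed.

Fact fps_one_neq0 : fps_one != 0.
Proof.
apply/eqP => /(congr1 (fun f => [q^ 0] f)) /= /eqP.
by rewrite oner_eq0.
Qed.

HB.instance Definition _ := GRing.Zmodule_isComNzRing.Build (fps K)
  fps_mulA fps_mulC fps_mul1 fps_mulDl fps_one_neq0.

Definition fps_scale (a : K) f : fps K := Fps (fun j => a * [q^ j] f).

Fact fps_scaleA a b f : fps_scale a (fps_scale b f) = fps_scale (a * b) f.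
Proof. by apply: fpsP => j /=; rewrite mulrA. Qed.
Fact fps_scale1 : left_id 1 fps_scale.
Proof. by move=> f; apply: fpsP => j /=; rewrite mul1r. Qed.
Fact fps_scaleDr : right_distributive fps_scale +%R.
Proof. by move=> a f g; apply: fpsP => j /=; rewrite mulrDr. Qed.
Fact fps_scaleDl f : {morph fps_scale^~ f : a b / a + b}.
Proof. by move=> a b; apply: fpsP => j /=; rewrite mulrDl. Qed.

HB.instance Definition _ := GRing.Zmodule_isLmodule.Build K (fps K)
  fps_scaleA fps_scale1 fps_scaleDr fps_scaleDl.

(* A power series is a unit iff its constant coefficient is; the coefficients
   d_n of its inverse solve [\sum_(i <= n) f_i * d_(n - i) = (n == 0)]. *)
Fixpoint fps_inv_seq f n : seq K :=
  if n is m.+1 then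
    let s := fps_inv_seq f m in
    rcons s (- ([q^ 0] f)^-1 * \sum_(i < m.+1) [q^ i.+1] f * s`_(m - i))
  else [:: ([q^ 0] f)^-1].

Definition fps_unit : {pred fps K} := fun f => [q^ 0] f \is a GRing.unit.
Definition fps_inv f : fps K :=
  if fps_unit f then Fps (fun n => (fps_inv_seq f n)`_n) else f.

Let size_inv_seq f n : size (fps_inv_seq f n) = n.+1.
Proof. by elim: n => //= n IHn; rewrite size_rcons IHn. Qed.

Let nth_inv_seq f n i : (i <= n)%N ->
  (fps_inv_seq f n)`_i = (fps_inv_seq f i)`_i.
Proof.
elim: n => [|n IHn]; first by rewrite leqn0 => /eqP ->.
rewrite leq_eqVlt => /predU1P[-> //|lt_in].
by rewrite /= nth_rcons size_inv_seq lt_in IHn.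
Qed.

Fact fps_mulV : {in fps_unit, left_inverse 1 fps_inv *%R}.
Proof.
move=> f uf; rewrite mulrC /fps_inv (uf : fps_unit f); apply: fpsP => -[|n] /=.
  by rewrite big_ord_recl big_ord0 addr0 /= divrr.
rewrite big_ord_recl /= nth_rcons size_inv_seq ltnn eqxx.
rewrite mulrA mulrN divrr // mulN1r addrC; apply/eqP; rewrite subr_eq0.
apply/eqP/eq_bigr => i _; congr (_ * _).
by rewrite subSS [RHS]nth_inv_seq ?leq_subr.
Qed.

Fact fps_unitPl f g : g * f = 1 -> fps_unit f.
Proof.
move/(congr1 (fun f => [q^ 0] f)) => /=.
rewrite big_ord_recl big_ord0 addr0 /= => gf1.
by apply/unitrP; exists ([q^ 0] g); split=> //; rewrite mulrC.
Qed.

Fact fps_inv_out : {in [predC fps_unit], fps_inv =1 id}.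
Proof. by move=> f /negbTE uf; rewrite /fps_inv [fps_unit f]uf. Qed.

HB.instance Definition _ := GRing.ComNzRing_hasMulInverse.Build (fps K)
  fps_mulV fps_unitPl fps_inv_out.

Definition fpsX : fps K := Fps (fun j => (j == 1%N)%:R).

(* [F = \sum_(n >= 1) u n] in the q-adic topology: each coefficient of the
   partial sums is eventually constant. *)
Definition fps_has_sum (u : nat -> fps K) (F : fps K) : Prop :=
  forall j, exists N, forall n, (N <= n)%N ->
    [q^ j] (\sum_(1 <= i < n) u i) = [q^ j] F.

End FpsRing.
Arguments fpsX {K}.

(* Infinite matrices and arithmetic functions are indexed by the positive
   integers: only the values at arguments >= 1 are ever used. *)
Section InfiniteMatrices.
Variable K : comUnitRingType.
Implicit Types M S : nat -> nat -> K.

Definition lower_triangular M : Prop :=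
  forall n k, (0 < n)%N -> (n < k)%N -> M n k = 0.

(* Rows of lower triangular matrices have finite support, so that the products
   [M S] and [S M] reduce to the finite sums below. *)
Definition lower_triangular_inverse M S : Prop :=
  lower_triangular S /\
  forall n k, (0 < n)%N -> (0 < k)%N ->
    \sum_(1 <= j < n.+1) M n j * S j k = (n == k)%:R /\
    \sum_(1 <= j < n.+1) S n j * M j k = (n == k)%:R.

End InfiniteMatrices.

Section Factorization.
Variable K : comUnitRingType.

Definition inv_coef (C : fps K) (j : int) : K :=
  if j is Posz m then [q^ m] C^-1 else 0.

Definition sinv (C : fps K) (gamma : nat -> K) (n k : nat) : K :=
  \sum_(d <- divisors n) inv_coef C (d%:Z - k%:Z) * gamma (n %/ d)%N.

Definition gamma_tilde (gamma : nat -> K) (n : nat) : K :=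
  \sum_(d <- divisors n) gamma d.

Definition a_tilde (gamma a : nat -> K) (k : nat) : K :=
  \sum_(d <- divisors k) a d * gamma_tilde gamma (k %/ d)%N.

End Factorization.

(* Main.v *)
(* Read off the coefficient of q^n, the Lambert series on the left is the
   divisor sum A(n) = sum_(d | n) a_d.  Let f be the series on the right and
   write * for Dirichlet convolution.  Multiplying the coefficients of C f by
   the matrix s^(-1) gives gamma * f, because [c_(d-k)] is the matrix of
   multiplication by 1/C; on the other hand it gives a~ = a * (gamma * 1),
   because s^(-1) s is the identity.  Hence gamma * f = gamma * A, and gamma
   can be cancelled since gamma(1) is a unit. *)

Require Import Defs.
From HB Require Import structures.
From mathcomp Require Import all_boot all_order all_algebra.
From mathcomp Require Import boolp reals.
From mathcomp.real_closed Require Import complex.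

Import GRing.Theory.
Local Open Scope ring_scope.

(** * Coefficients of [fpsX ^+ n] and of a single Lambert term *)

Lemma coef_fpsXM (K : comUnitRingType) (f : fps K) j :
  [q^ j] (fpsX * f) = if j is m.+1 then [q^ m] f else 0.
Proof.
case: j => [|m] /=; first by rewrite big_ord_recl big_ord0 addr0 mul0r.
rewrite big_ord_recl mul0r add0r big_ord_recl /= mul1r subSS subn0 big1 ?addr0 //.
by move=> i _; rewrite mul0r.
Qed.

Lemma coef_fpsXnM (K : comUnitRingType) (f : fps K) n j :
  [q^ j] (fpsX ^+ n * f) = if (n <= j)%N then [q^ (j - n)] f else 0.
Proof.
elim: n j => [|n IHn] j; first by rewrite expr0 mul1r subn0.
by rewrite exprS -mulrA coef_fpsXM; case: j => // m; rewrite IHn ltnS subSS.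
Qed.

Lemma coef_fpsXn (K : comUnitRingType) n j :
  [q^ j] (fpsX ^+ n : fps K) = (j == n)%:R.
Proof.
rewrite -[fpsX ^+ n]mulr1 coef_fpsXnM /= subn_eq0 eqn_leq andbC.
by case: (n <= j)%N.
Qed.

Lemma fps_coef_sum (K : comUnitRingType) (I : Type) (r : seq I) (P : pred I)
    (F : I -> fps K) j :
  [q^ j] (\sum_(i <- r | P i) F i) = \sum_(i <- r | P i) [q^ j] (F i).
Proof. exact: (big_morph (fun f => [q^ j] f)). Qed.

(** Let G be the indicator series of the positive multiples of n. Shifting G by n loses only the
    multiple n itself, so G - q^n G = q^n, and 1 - q^n can be divided out. *)
Lemma coef_lambert (K : comUnitRingType) n j : (0 < n)%N ->
  [q^ j] (fpsX ^+ n / (1 - fpsX ^+ n) : fps K) = ((n %| j) && (0 < j))%N%:R.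
Proof.
move=> n_gt0.
have unitD : (1 - fpsX ^+ n : fps K) \is a GRing.unit.
  (* Invertibility of a power series is by definition that of its constant coefficient, here 1 since
     n > 0. *)
  change (is_true (([q^ 0] (1 - fpsX ^+ n : fps K)) \is a GRing.unit)).
  by rewrite /= coef_fpsXn eq_sym (gtn_eqF n_gt0) subr0 unitr1.
pose G : fps K := Fps (fun j => ((n %| j) && (0 < j))%N%:R).
suff <-: G = fpsX ^+ n / (1 - fpsX ^+ n) by [].
apply: (mulIr unitD); rewrite mulrVK // mulrBr mulr1 [G * _]mulrC.
apply: fpsP => {}j.
rewrite -[LHS]/([q^ j] G - [q^ j] (fpsX ^+ n * G)) coef_fpsXnM coef_fpsXn /=.
case: (ltngtP j n) => [lt_jn|lt_nj|->]; rewrite ?subr0 ?subrr.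
- by case: j lt_jn => [|j] lt_jn; rewrite ?andbF // gtnNdvd.
- rewrite subn_gt0 lt_nj (leq_ltn_trans _ lt_nj) //.
  by rewrite dvdn_subl ?dvdnn ?subrr // ltnW.
- by rewrite subnn dvdnn n_gt0 andbF subr0.
Qed.

(** * Divisor sums and Dirichlet convolution *)

Lemma sum_divisors_filter (K : nmodType) (F : nat -> K) m n :
  (0 < n)%N -> (m %| n)%N ->
  \sum_(d <- divisors n | (d %| m)%N) F d = \sum_(d <- divisors m) F d.
Proof.
move=> n_gt0 m_n; have m_gt0 : (0 < m)%N := dvdn_gt0 n_gt0 m_n.
rewrite -big_filter; apply: perm_big; apply: uniq_perm.
- by rewrite filter_uniq ?divisors_uniq.
- exact: divisors_uniq.
move=> d; rewrite mem_filter -!dvdn_divisors //.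
by apply: andb_idr => /dvdn_trans; apply.
Qed.

(** The involution e -> n / e maps the divisors of n / d bijectively onto the divisors of n that are
    multiples of d. *)
Lemma sum_codivisors (K : nmodType) (F : nat -> K) d n :
  (0 < n)%N -> (d %| n)%N ->
  \sum_(e <- divisors (n %/ d)) F e =
  \sum_(g <- divisors n | (d %| g)%N) F (n %/ g)%N.
Proof.
move=> n_gt0 d_n; have d_gt0 : (0 < d)%N := dvdn_gt0 n_gt0 d_n.
have nd_gt0 : (0 < n %/ d)%N by rewrite divn_gt0 // dvdn_leq.
have codivK e : (e %| n)%N -> (n %/ (n %/ e))%N = e.
  by move=> e_n; rewrite divnA // mulKn.
have dvd_n e : e \in divisors (n %/ d) -> (e %| n)%N.
  by rewrite -dvdn_divisors // => /dvdn_trans; apply; apply: dvdn_div.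
rewrite -[RHS]big_filter.
have eq_s : perm_eq [seq g <- divisors n | (d %| g)%N]
                           [seq (n %/ e)%N | e <- divisors (n %/ d)].
  apply: uniq_perm; first by rewrite filter_uniq ?divisors_uniq.
    rewrite map_inj_in_uniq ?divisors_uniq // => e1 e2 /dvd_n e1n /dvd_n e2n e12.
    by rewrite -(codivK e1) // e12 codivK.
  move=> g; rewrite mem_filter -dvdn_divisors //.
  apply/andP/mapP => [[d_g g_n] | [e e_nd ->]].
    exists (n %/ g)%N; last by rewrite codivK.
    rewrite -dvdn_divisors // dvdn_divRL //.
    by rewrite -[X in (_ %| X)%N](divnK g_n) dvdn_mul.
  have e_n := dvd_n _ e_nd; split; last exact: dvdn_div.
  move: e_nd; rewrite -dvdn_divisors // dvdn_divRL // mulnC => de_n.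
  by rewrite dvdn_divRL.
rewrite (perm_big _ eq_s) big_map big_seq [RHS]big_seq.
apply: eq_bigr => e /dvd_n e_n.
by rewrite codivK.
Qed.

(** This is a * (gamma * 1) = gamma * (a * 1): both are sums over chains d | g | n, taken in either
    order. *)
Lemma a_tildeE (K : comUnitRingType) (gamma a : nat -> K) n : (0 < n)%N ->
  a_tilde gamma a n =
  \sum_(g <- divisors n) gamma (n %/ g)%N * \sum_(d <- divisors g) a d.
Proof.
move=> n_gt0; rewrite /a_tilde /gamma_tilde.
transitivity (\sum_(d <- divisors n)
    \sum_(g <- divisors n | (d %| g)%N) a d * gamma (n %/ g)%N).
  apply: eq_big_seq => d; rewrite -dvdn_divisors // => d_n.
  by rewrite sum_codivisors // mulr_sumr.
rewrite (exchange_big_dep predT) //=.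
apply: eq_big_seq => g; rewrite -dvdn_divisors // => g_n.
by rewrite -mulr_suml mulrC sum_divisors_filter.
Qed.

(** By strong induction the terms with d < n agree on both sides, which leaves gamma(1) f(n) =
    gamma(1) g(n). *)
Lemma dirichlet_cancel (K : comUnitRingType) (gamma f g : nat -> K) :
  gamma 1%N \is a GRing.unit ->
  (forall n, (0 < n)%N ->
     \sum_(d <- divisors n) gamma (n %/ d)%N * f d =
     \sum_(d <- divisors n) gamma (n %/ d)%N * g d) ->
  forall n, (0 < n)%N -> f n = g n.
Proof.
move=> ug fg; elim/ltn_ind => n IHn n_gt0; have := fg n n_gt0.
rewrite !(bigD1_seq n) ?divisors_uniq -?dvdn_divisors //= divnn n_gt0.
have -> : \sum_(d <- divisors n | d != n) gamma (n %/ d)%N * f d =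
          \sum_(d <- divisors n | d != n) gamma (n %/ d)%N * g d.
  rewrite big_seq_cond [RHS]big_seq_cond; apply: eq_bigr => d.
  rewrite -dvdn_divisors // => /andP[d_n neq_dn].
  by rewrite IHn ?(dvdn_gt0 n_gt0) // ltn_neqAle neq_dn dvdn_leq.
by move=> /addIr/(mulrI ug).
Qed.

(** * The matrix [sinv] and its action on coefficient sequences *)

Lemma inv_coefE (K : comUnitRingType) (C : fps K) d k :
  inv_coef C (d%:Z - k%:Z) = if (k <= d)%N then [q^ (d - k)] C^-1 else 0.
Proof.
case: leqP => [le_kd | lt_dk]; first by rewrite subzn.
by rewrite -opprB subzn 1?ltnW // -(subnSK lt_dk) -NegzE.
Qed.

(** After exchanging the sums, the inner sum over k is a Cauchy product, cut off at k = d because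
    c_(d-k) = 0 beyond. The Cauchy product starts at index 0 and the matrix at 1, hence the
    condition on [b 0]. *)
Lemma sum_sinv (K : comUnitRingType) (C : fps K) (gamma b : nat -> K) n :
  (0 < n)%N -> b 0%N = 0 ->
  \sum_(1 <= k < n.+1) sinv C gamma n k * b k =
  \sum_(d <- divisors n) gamma (n %/ d)%N * [q^ d] (C^-1 * Fps b).
Proof.
move=> n_gt0 b0; rewrite /sinv.
under eq_bigr => k _ do rewrite mulr_suml.
rewrite exchange_big; apply: eq_big_seq => d.
rewrite -dvdn_divisors // => /(dvdn_leq n_gt0) le_dn.
under eq_bigr => k _ do rewrite mulrAC mulrC.
rewrite -mulr_sumr; congr (_ * _).
rewrite [C^-1 * _]mulrC /=.
rewrite -(big_mkord xpredT (fun i => b i * [q^ (d - i)] C^-1)).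
rewrite [RHS]big_ltn // b0 mul0r add0r (@big_cat_nat _ _ _ d.+1) //=.
rewrite [X in _ + X]big_nat_cond [X in _ + X]big1 => [|k].
  rewrite addr0 big_nat_cond [RHS]big_nat_cond.
  apply: eq_bigr => k /andP[/andP[_ lt_kd] _].
  by rewrite inv_coefE -ltnS lt_kd mulrC.
by case/andP => /andP[lt_dk _] _; rewrite inv_coefE leqNgt lt_dk mul0r.
Qed.

Lemma sinv_lower_triangular (K : comUnitRingType) (C : fps K) gamma :
  lower_triangular (sinv C gamma).
Proof.
move=> n k n_gt0 lt_nk; rewrite /sinv big1_seq // => d /=.
rewrite -dvdn_divisors // => /(dvdn_leq n_gt0) le_dn.
by rewrite inv_coefE leqNgt (leq_ltn_trans le_dn lt_nk) mul0r.
Qed.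

Lemma sinv_diag (K : comUnitRingType) (C : fps K) gamma n : (0 < n)%N ->
  sinv C gamma n n = [q^ 0] C^-1 * gamma 1%N.
Proof.
move=> n_gt0; rewrite /sinv (bigD1_seq n) ?divisors_uniq -?dvdn_divisors //=.
rewrite inv_coefE leqnn subnn divnn n_gt0 big_seq_cond big1 ?addr0 // => d.
rewrite -dvdn_divisors // => /andP[/(dvdn_leq n_gt0) le_dn neq_dn].
by rewrite inv_coefE leqNgt ltn_neqAle neq_dn le_dn mul0r.
Qed.

Lemma coef0_fpsV (K : comUnitRingType) (C : fps K) :
  [q^ 0] C^-1 = ([q^ 0] C)^-1.
Proof.
have [uC | nuC] := boolP ([q^ 0] C \is a GRing.unit); last first.
  (* Inversion returns non-units unchanged, in both rings. *)
  by rewrite !invr_out.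
have /mulrV/(congr1 (fun f => [q^ 0] f)) : C \is a GRing.unit by [].
rewrite /= big_ord_recl big_ord0 addr0 => CV0.
by apply: (mulrI uC); rewrite CV0 mulrV.
Qed.

(** * Inversion of infinite lower triangular matrices *)

(** Everything reduces to finite leading blocks, whose determinants are products of diagonal entries
    and hence units. *)
Lemma lower_triangular_inverse_exists (K : comUnitRingType)
    (M : nat -> nat -> K) :
  lower_triangular M -> (forall n, (0 < n)%N -> M n n \is a GRing.unit) ->
  exists S, lower_triangular_inverse M S.
Proof.
move=> trM unitM.
pose blk (T : nat -> nat -> K) m : 'M[K]_m.+1 := \matrix_(i, j) T i.+1 j.+1.
have unit_blk m : blk M m \in unitmx.
  rewrite unitmxE det_trig; last first.
    by apply/is_trig_mxP => i j lt_ij; rewrite mxE trM.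
  by apply: rpred_prod => i _; rewrite mxE unitM.
(* Row n of the inverse is the last row of the inverse of the n x n block. *)
pose S n k :=
  if (0 < k <= n)%N then invmx (blk M n.-1) ord_max (inord k.-1) else 0.
have trS : lower_triangular S.
  by move=> n k _ lt_nk; rewrite /S [(k <= n)%N]leqNgt lt_nk andbF.
(* Row n of a triangular matrix vanishes past n, so its sums can be computed in any block of size at
   least n. *)
have widen (A B : nat -> nat -> K) n k m : lower_triangular A -> (0 < n <= m.+1)%N ->
    \sum_(1 <= j < n.+1) A n j * B j k = \sum_(i < m.+1) A n i.+1 * B i.+1 k.
  move=> trA /andP[n_gt0 le_nm].
  rewrite -(big_mkord xpredT (fun i => A n i.+1 * B i.+1 k)).
  rewrite big_add1 /= [RHS](@big_cat_nat _ _ _ n) //= [X in _ + X]big_nat_cond.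
  rewrite [X in _ + X]big1 ?addr0 // => j /andP[/andP[le_nj _] _].
  by rewrite trA // mul0r.
have SM n k : (0 < n)%N -> (0 < k)%N ->
    \sum_(1 <= j < n.+1) S n j * M j k = (n == k)%:R.
  case: n k => [|n] [|k] // _ _; case: (leqP k n) => [le_kn | lt_nk].
    have := congr1 (fun A : 'M_n.+1 => A ord_max (inord k)) (mulVmx (unit_blk n)).
    rewrite !mxE (widen S M _ _ n) //= => SMnk.
    rewrite eqSS; move: SMnk; rewrite -val_eqE /= inordK // => <-.
    apply: eq_bigr => j _; rewrite !mxE /S /= ltn_ord inordK //.
    by rewrite inord_val.
  rewrite eqSS (ltn_eqF lt_nk) big_nat_cond big1 // => j.
  case/andP=> /andP[j_gt0 lt_jn] _.
  by rewrite trM ?mulr0 // (leq_trans lt_jn).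
exists S; split=> // n k n_gt0 k_gt0; split; last exact: SM.
case: n k n_gt0 k_gt0 => [|n] [|k] // _ _.
(* The rows of [S] come from blocks of different sizes, so only S M = 1 is obtained directly. In a
   block containing both indices, a left inverse of a square matrix is also a right inverse. *)
have /mulmx1C : blk S (maxn n k) *m blk M (maxn n k) = 1%:M.
  apply/matrixP => i j; rewrite !mxE -val_eqE -eqSS -SM //.
  rewrite (widen S M _ _ (maxn n k)) ?ltn_ord //.
  by apply: eq_bigr => l _; rewrite !mxE.
have lt_n : (n < (maxn n k).+1)%N by rewrite ltnS leq_maxl.
have lt_k : (k < (maxn n k).+1)%N by rewrite ltnS leq_maxr.
move/matrixP/(_ (Ordinal lt_n) (Ordinal lt_k)).
rewrite !mxE -val_eqE /= eqSS => <-.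
rewrite (widen M S _ _ (maxn n k)) //.
by apply: eq_bigr => l _; rewrite !mxE.
Qed.

(** * Summing the Lambert series and assembling the factorization *)

Lemma lambert_has_sum (K : comUnitRingType) (a : nat -> K) (F : fps K) :
  [q^ 0] F = 0 ->
  (forall j, (0 < j)%N -> [q^ j] F = \sum_(d <- divisors j) a d) ->
  fps_has_sum (fun n => (a n *: fpsX ^+ n) / (1 - fpsX ^+ n)) F.
Proof.
(* Terms of index above j do not reach q^j, so the partial sums are stable once they include the
   index j. *)
move=> F0 FS j; exists j.+1 => n lt_jn.
rewrite fps_coef_sum.
transitivity (\sum_(1 <= i < n | ((i %| j) && (0 < j))%N) a i).
  rewrite big_nat_cond [RHS]big_mkcond [RHS]big_nat_cond.
  apply: eq_bigr => i /andP[/andP[i_gt0 _] _].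
  rewrite [LHS](_ : _ = a i * [q^ j] (fpsX ^+ i / (1 - fpsX ^+ i))).
    by rewrite coef_lambert //; case: ifP; rewrite ?mulr1 ?mulr0.
  rewrite /= mulr_sumr; by apply: eq_bigr => l _; rewrite mulrA.
case: (posnP j) lt_jn => [-> _ | j_gt0 lt_jn].
  by rewrite F0 big1 // => i; rewrite andbF.
rewrite FS // -big_filter; apply/perm_big/uniq_perm.
- by rewrite filter_uniq ?iota_uniq.
- exact: divisors_uniq.
move=> d; rewrite mem_filter mem_index_iota -dvdn_divisors // andbT.
apply: andb_idr => d_j; rewrite (dvdn_gt0 j_gt0 d_j) /=.
exact: leq_ltn_trans (dvdn_leq j_gt0 d_j) lt_jn.
Qed.

Lemma lambert_factorization (K : comUnitRingType) (C : fps K)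
    (gamma a : nat -> K) (s : nat -> nat -> K) :
  gamma 1%N \is a GRing.unit -> lower_triangular_inverse (sinv C gamma) s ->
  fps_has_sum (fun n => (a n *: fpsX ^+ n) / (1 - fpsX ^+ n))
    (C^-1 * Fps (fun n => \sum_(1 <= k < n.+1) s n k * a_tilde gamma a k)).
Proof.
move=> ug [trs sP]; pose b n := \sum_(1 <= k < n.+1) s n k * a_tilde gamma a k.
have b0 : b 0%N = 0 by rewrite /b big_geq.
apply: lambert_has_sum.
  by rewrite /= big_ord_recl big_ord0 addr0 subnn [X in _ * X]b0 mulr0.
apply: (dirichlet_cancel _ gamma) => // n n_gt0.
(* The left side becomes s^(-1) applied to b, the right side the n-th entry of a~. *)
rewrite -(sum_sinv K C gamma b) // -a_tildeE //.
(* Padding row j of s with zeros up to n makes the range of k independent of j, so that the two sums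
   can be exchanged. *)
have bE j : (0 < j < n.+1)%N ->
    b j = \sum_(1 <= k < n.+1) s j k * a_tilde gamma a k.
  move=> /andP[j_gt0 le_jn]; rewrite /b [RHS](@big_cat_nat _ _ _ j.+1) //=.
  rewrite [X in _ + X]big_nat_cond [X in _ + X]big1 ?addr0 // => k.
  by case/andP=> /andP[lt_jk _] _; rewrite trs ?mul0r.
rewrite big_nat_cond.
under eq_bigr => j /andP[/bE-> _] do rewrite mulr_sumr.
rewrite -big_nat_cond exchange_big /= big_nat_cond.
under eq_bigr => k /andP[/andP[k_gt0 _] _].
  under eq_bigr => j _ do rewrite mulrA.
  rewrite -mulr_suml (sP _ _ n_gt0 k_gt0).1; over.
(* The inner sums are now entries of the identity matrix, so only k = n survives. *)
rewrite -big_nat_cond (bigD1_seq n) ?iota_uniq ?mem_index_iota ?n_gt0 ?ltnSn //=.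
rewrite eqxx mul1r big1 ?addr0 // => k.
by rewrite eq_sym => /negPf->; rewrite mul0r.
Qed.

Theorem theorem3 (R : realType) (C : fps R[i]) (gamma : nat -> R[i])
    (hC : [q^ 0] C = 1) (hgamma : gamma 1%N <> 0) :
  [/\ lower_triangular (sinv C gamma),
      forall n : nat, (0 < n)%N -> sinv C gamma n n = gamma 1%N,
      exists s : nat -> nat -> R[i],
        lower_triangular_inverse (sinv C gamma) s
    & forall (s : nat -> nat -> R[i]) (a : nat -> R[i]),
        lower_triangular_inverse (sinv C gamma) s ->
        fps_has_sum (fun n : nat => (a n *: fpsX ^+ n) / (1 - fpsX ^+ n))
          (C^-1 * Fps (fun n : nat =>
             \sum_(1 <= k < n.+1) s n k * a_tilde gamma a k))].
Proof.
have ug : gamma 1%N \is a GRing.unit by rewrite unitfE; apply/eqP.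
have diagE n : (0 < n)%N -> sinv C gamma n n = gamma 1%N.
  by move=> n_gt0; rewrite sinv_diag // coef0_fpsV hC invr1 mul1r.
split=> // [|| s a]; last exact: lambert_factorization.
- exact: sinv_lower_triangular.
- apply: lower_triangular_inverse_exists => [|n n_gt0]; last by rewrite diagE.
  exact: sinv_lower_triangular.
Qed.
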